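(* Let $A$ be a C*-algebra and let $\mathcal M\subset\mathcal N$ be two Hilbert $A$-modules such that $\mathcal M^\perp=\{0\}$ with respect to $\mathcal N$. Let $r:\mathcal N\to A$ be a non-zero bounded $A$-linear functional such that $r|_{\mathcal M}=0$. Then $Ar\cap\mathcal N=\{0\}$ in $\mathcal N'$. Moreover, the kernel of $r$ is not biorthogonally complemented in $\mathcal N$, but it is norm-complete.
   Context: Hilbert $A$-modules are left modules, complete in norm, with $A$-valued inner product $\langle\cdot,\cdot\rangle$ that is $A$-linear in the first entry; $\mathcal M$ is a Hilbert $A$-submodule of $\mathcal N$ with the restricted inner product. $\mathcal M^\perp=\{n\in\mathcal N:\langle n,m\rangle=0\ \forall m\in\mathcal M\}$. A submodule $\mathcal K\subseteq\mathcal N$ is biorthogonally complemented if $\mathcal K=\mathcal K^{\perp\perp}$. $\mathcal N'$ is the Banach $A$-module of all bounded $A$-linear maps $\mathcal N\to A$ with left action $(ar)(n)=r(n)a^*$, and $\mathcal N$ is identified with its image under the isometric $A$-linear embedding $\mathcal N\to\mathcal N'$, $x\mapsto\langle\cdot,x\rangle$. $Ar=\{ar:a\in A\}\subseteq\mathcal N'$. *)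

(* Defs.v *)
From HB Require Import structures.
From mathcomp Require Import all_boot all_order all_algebra.
From mathcomp Require Import complex.
From mathcomp Require Import boolp classical_sets reals topology normedtype.

Set Implicit Arguments.
Unset Strict Implicit.
Unset Printing Implicit Defensive.

Import Order.TTheory GRing.Theory Num.Theory.
Import numFieldNormedType.Exports.
Local Open Scope classical_set_scope.
Local Open Scope complex_scope.
Local Open Scope ring_scope.

(* C*-algebras need not have a unit, so the product is introduced here rather
   than inherited from MathComp's rings, which are all unital. *)
HB.mixin Record isCStarAlgebra (R : realType) A
    of CompleteNormedModule R[i] A := {
  cmul : A -> A -> A;
  cstar : A -> A;
  cmulA : associative cmul;
  cmulDl : left_distributive cmul +%R;
  cmulDr : right_distributive cmul +%R;
  cmulZl : forall (k : R[i]) a b, cmul (k *: a) b = k *: cmul a b;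
  cmulZr : forall (k : R[i]) a b, cmul a (k *: b) = k *: cmul a b;
  cstarK : involutive cstar;
  cstarD : {morph cstar : a b / a + b};
  cstarZ : forall (k : R[i]) a, cstar (k *: a) = k^* *: cstar a;
  cstarM : forall a b, cstar (cmul a b) = cmul (cstar b) (cstar a);
  cnormM : forall a b, `|cmul a b| <= `|a| * `|b|;
  cnorm_star : forall a, `|cmul (cstar a) a| = `|a| ^+ 2
}.

#[short(type="cstarAlgebraType")]
HB.structure Definition CStarAlgebra (R : realType) :=
  { A of isCStarAlgebra R A & CompleteNormedModule R[i] A }.

Definition cpositive (R : realType) (A : cstarAlgebraType R) (a : A) : Prop :=
  exists b : A, a = cmul (cstar b) b.

(* Definiteness of [inner] follows from [normE]. *)
HB.mixin Record isHilbertModule (R : realType) (A : cstarAlgebraType R) N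
    of CompleteNormedModule R[i] N := {
  act : A -> N -> N;
  actDl : forall a b x, act (a + b) x = act a x + act b x;
  actDr : forall a x y, act a (x + y) = act a x + act a y;
  actM : forall a b x, act (cmul a b) x = act a (act b x);
  actZl : forall (k : R[i]) a x, act (k *: a) x = k *: act a x;
  actZr : forall (k : R[i]) a x, act a (k *: x) = k *: act a x;
  inner : N -> N -> A;
  innerDl : forall x y z, inner (x + y) z = inner x z + inner y z;
  innerZl : forall (k : R[i]) x z, inner (k *: x) z = k *: inner x z;
  inner_actl : forall a x z, inner (act a x) z = cmul a (inner x z);
  inner_star : forall x y, cstar (inner x y) = inner y x;
  inner_ge0 : forall x, cpositive (inner x x);
  normE : forall x, `|x| ^+ 2 = `|inner x x|
}.

#[short(type="hilbertModType")]
HB.structure Definition HilbertModule (R : realType) (A : cstarAlgebraType R) :=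
  { N of isHilbertModule R A N & CompleteNormedModule R[i] N }.

Section HilbertModuleDefs.
Context {R : realType} {A : cstarAlgebraType R} {N : hilbertModType A}.
Implicit Types (K M : set N).

Definition norm_complete K : Prop :=
  forall u : nat -> N, (forall n, K (u n)) -> cauchy (u @ \oo) ->
  exists2 x, K x & u @ \oo --> x.

Record hilbert_submodule M : Prop := HilbertSubmodule {
  submod0 : M 0;
  submodD : forall x y, M x -> M y -> M (x + y);
  submodZ : forall (k : R[i]) x, M x -> M (k *: x);
  submod_act : forall (a : A) x, M x -> M (act a x);
  submod_complete : norm_complete M
}.

Definition orthocomp K : set N :=
  [set x | forall y, K y -> inner x y = 0 :> A].

Definition biorth_complemented K : Prop := K = orthocomp (orthocomp K).

End HilbertModuleDefs.

Section DualModule.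
Context {R : realType} {A : cstarAlgebraType R}.

Record dual (N : hilbertModType A) := Dual {
  dual_fun :> N -> A;
  dual_linear : linear dual_fun;
  dual_act_lin : forall (a : A) x, dual_fun (act a x) = cmul a (dual_fun x);
  dual_bounded : exists C : R, forall x, `|dual_fun x| <= C%:C * `|x|
}.

Context {N : hilbertModType A}.

Lemma dual_eq (r s : dual N) : (forall x, r x = s x) -> r = s.
Proof.
case: r s => [f fL fA fB] [g gL gA gB] /= /funext fg.
case: g / fg gL gA gB => gL gA gB.
by congr Dual; exact: Prop_irrelevance.
Qed.

Lemma cmulr0 (a : A) : cmul a 0 = 0 :> A.
Proof. by rewrite -(scale0r (0 : A)) cmulZr !scale0r. Qed.

Definition dual0 : dual N.
Proof.
exists (fun=> 0).
- by move=> k x y /=; rewrite scaler0 addr0.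
- by move=> a x; rewrite cmulr0.
- by exists 0 => x; rewrite normr0 mul0r.
Defined.

Definition dual_act (a : A) (r : dual N) : dual N.
Proof.
exists (fun x => cmul (r x) (cstar a)).
- by move=> k x y; rewrite dual_linear cmulDl cmulZl.
- by move=> b x; rewrite dual_act_lin cmulA.
- have [C rC] := dual_bounded r; exists (C * complex.Re `|cstar a|) => x.
  have -> : (C * complex.Re `|cstar a|)%:C = C%:C * `|cstar a|.
    by rewrite rmorphM /= RRe_real // normr_real.
  apply: le_trans (cnormM _ _) _; rewrite mulrAC.
  exact: (ler_wpM2r (normr_ge0 _) (rC x)).
Defined.

(* The image of [N] in [dual N] under [x |-> <., x>]. *)
Definition dual_range : set (dual N) :=
  [set s | exists x : N, forall n, s n = inner n x].

Definition dual_orbit (r : dual N) : set (dual N) :=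
  [set dual_act a r | a in [set: A]].

Definition dual_ker (r : dual N) : set N := [set n | r n = 0].

End DualModule.

(* Main.v *)
Require Import Defs.
From mathcomp Require Import all_boot all_order all_algebra.
From mathcomp Require Import complex.
From mathcomp Require Import boolp classical_sets reals topology normedtype.
Import Order.TTheory GRing.Theory Num.Theory.
Import numFieldNormedType.Exports.
Local Open Scope classical_set_scope.
Local Open Scope ring_scope.

(** If [dual_act a r] is the functional $\langle\cdot,x\rangle$, then for $m\in M$ one gets $\langle
    m,x\rangle=r(m)a^*=0$, so $x\in M^\perp=0$. Since $M\subseteq\ker r$, also $(\ker
    r)^\perp\subseteq M^\perp=0$; by [biorth_complemented_setT] a biorthogonally complemented kernel
    would be all of $N$, forcing $r=0$. Completeness of the kernel ([dual_ker_complete]) is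
    closedness under a bounded map inside the complete module $N$. *)

Section Orthocomplements.
Context {R : realType} {A : cstarAlgebraType R} {N : hilbertModType A}.

Lemma cstar0 : cstar 0 = 0 :> A.
Proof. by rewrite -(scale0r (0 : A)) cstarZ rmorph0 !scale0r. Qed.

Lemma inner_eq0C (x y : N) : inner x y = 0 :> A -> inner y x = 0 :> A.
Proof. by rewrite -(inner_star x y) => ->; exact: cstar0. Qed.

Lemma inner0r (x : N) : inner x 0 = 0 :> A.
Proof. by apply: inner_eq0C; rewrite -(scale0r (0 : N)) innerZl scale0r. Qed.

Lemma orthocompS (K L : set N) : K `<=` L -> orthocomp L `<=` orthocomp K.
Proof. by move=> KL x Lx y /KL/Lx. Qed.

Lemma orthocomp_set0 : orthocomp [set 0] = [set: N].
Proof. by apply/seteqP; split => // x _ y ->; exact: inner0r. Qed.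

(** Complements reverse inclusions, so $K^\perp\subseteq 0$ gives $K^{\perp\perp}\supseteq
    0^\perp=N$. *)
Lemma biorth_complemented_setT (K : set N) :
  orthocomp K `<=` [set 0] -> biorth_complemented K -> K = setT.
Proof.
move=> /orthocompS; rewrite orthocomp_set0 => KT ->.
by apply/seteqP; split => // x /KT.
Qed.

End Orthocomplements.

Section DualKernel.
Context {R : realType} {A : cstarAlgebraType R} {N : hilbertModType A}.

Lemma dual_funB (r : dual N) (x y : N) : r (x - y) = r x - r y.
Proof. by rewrite -scaleN1r addrC dual_linear scaleN1r addrC. Qed.

Lemma dual_ker_complete (r : dual N) : norm_complete (dual_ker r).
Proof.
move=> u ru /cauchy_cvg u_cvg.
exists (lim (u @ \oo)) => //; set x := lim _ in u_cvg *.
have [C rC] := dual_bounded r.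
apply/eqP/negPn/negP => rx0.
(* The bound [C] may be zero or negative; [c] dominates it and is positive, so it can be divided
   by. *)
pose c : R[i] := `|C%:C%C| + 1.
have c_gt0 : 0 < c by rewrite ltr_wpDl.
have e_gt0 : 0 < `|r x| / c by rewrite divr_gt0 ?normr_gt0.
have /cvgr_distC_lt/(_ _ e_gt0)/filter_ex[n] := u_cvg.
rewrite distrC ltr_pdivlMr // => /lt_geF/negP; apply.
(* As [r (u n) = 0], $|r(x)|=|r(x-u_n)|\le C|x-u_n|\le c|x-u_n|$, against the choice of [n]. *)
rewrite -[r x]subr0 -(ru n) -dual_funB (le_trans (rC _)) // mulrC.
apply: ler_wpM2l => //; rewrite /c (@le_trans _ _ `|C%:C%C|) ?lerDl //.
by apply: real_ler_norm; rewrite realE !lecR le_total.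
Qed.

End DualKernel.

Theorem theorem5p1 (R : realType) (A : cstarAlgebraType R)
    (N : hilbertModType A) (M : set N) (hM : hilbert_submodule M)
    (hMperp : orthocomp M = [set 0])
    (r : dual N) (hr : r <> dual0) (hrM : forall m, M m -> r m = 0) :
  dual_orbit r `&` dual_range = [set dual0] /\
  ~ biorth_complemented (dual_ker r) /\
  norm_complete (dual_ker r).
Proof.
split; [|split; last exact: dual_ker_complete].
- apply/seteqP; split=> s.
    move=> [[a _ <-]] [x sx]; apply: dual_eq => n.
    suff x0 : x = 0 by rewrite sx x0 inner0r.
    suff : orthocomp M x by rewrite hMperp.
    move=> m Mm; apply: inner_eq0C.
    by rewrite -sx /= hrM // -(scale0r (0 : A)) cmulZl !scale0r.
  (* The zero functional is both $0\cdot r$ and $\langle\cdot,0\rangle$. *)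
  move=> ->; split.
    by exists 0 => //; apply: dual_eq => n /=; rewrite cstar0 cmulr0.
  by exists 0 => n /=; rewrite inner0r.
- move=> /biorth_complemented_setT kerT; apply: hr; apply: dual_eq => x.
  suff : dual_ker r x by [].
  (* What remains is $(\ker r)^\perp\subseteq M^\perp$, which holds because [hrM] says
     $M\subseteq\ker r$. *)
  by rewrite kerT // -hMperp; exact: orthocompS.
Qed.
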